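(* Let $\theta=(1,\theta_1,\theta_2)'$ where $(\theta_1,\theta_2)\in\mathbb{R}^2$ satisfies $\theta_2>0$, $\theta_2<1$, $\theta_1+\theta_2>0$ and $\theta_1-\theta_2<1$ (sub-region 3 of the invertibility region of MA(2) processes). For $0<\alpha\le 2$ let $$g_\alpha(\theta)=\sum_{i=0}^{q-1}\Big|\sum_{j=0}^{i}\theta_j\Big|^\alpha-q\Big|\sum_{i=0}^{q}\theta_i\Big|^\alpha+\sum_{i=1}^{q}\Big|\sum_{j=i}^{q}\theta_j\Big|^\alpha$$ with $q=2$ and $\theta_0=1$, that is, $$g_\alpha(\theta)=1+|1+\theta_1|^\alpha-2|1+\theta_1+\theta_2|^\alpha+|\theta_1+\theta_2|^\alpha+|\theta_2|^\alpha.$$ Then $g_\alpha(\theta)>0$ if $0<\alpha<1$; $g_\alpha(\theta)=0$ if $\alpha=1$; and $g_\alpha(\theta)<0$ if $1<\alpha\le2$.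
   Context: The invertibility region of MA(2) processes is the set of $(\theta_1,\theta_2)\in\mathbb{R}^2$ for which all roots of $1+\theta_1z+\theta_2z^2$ lie in $|z|>1$, i.e. $\theta_2<1$, $\theta_1+\theta_2>-1$ and $\theta_1-\theta_2<1$. Sub-region 3 is the open subset of it defined by the four inequalities in the claim. *)

(* Defs.v *)
From mathcomp Require Import all_boot all_order all_algebra.
From mathcomp Require Import reals exp.
Set Implicit Arguments.
Unset Strict Implicit.
Unset Printing Implicit Defensive.
Import Order.TTheory GRing.Theory Num.Theory.
Local Open Scope ring_scope.

(* The dimension of theta determines the order q, and theta_i is theta i 0.
   For 0 < alpha, powR gives 0 `^ alpha = 0, the usual convention. *)
Definition g (R : realType) (q : nat) (alpha : R) (theta : 'cV[R]_q.+1) : R :=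
  \sum_(i < q) `|\sum_(j < q.+1 | (j <= i)%N) theta j 0| `^ alpha
  - q%:R * `|\sum_(i < q.+1) theta i 0| `^ alpha
  + \sum_(i < q.+1 | (1 <= i)%N)
      `|\sum_(j < q.+1 | (i <= j)%N) theta j 0| `^ alpha.

Definition ma2_coef (R : realType) (theta1 theta2 : R) : 'cV[R]_3 :=
  \col_(i < 3) [:: 1; theta1; theta2]`_i.

Lemma g_ma2E (R : realType) (alpha theta1 theta2 : R) :
  g alpha (ma2_coef theta1 theta2) =
    1 + `|1 + theta1| `^ alpha - 2 * `|1 + theta1 + theta2| `^ alpha
    + `|theta1 + theta2| `^ alpha + `|theta2| `^ alpha.
Proof.
have sumE (P : pred 'I_3) (F : 'I_3 -> R) : \sum_(i | P i) F i =
    (if P (inord 0) then F (inord 0) else 0)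
    + (if P (inord 1) then F (inord 1) else 0)
    + (if P (inord 2) then F (inord 2) else 0).
  rewrite big_mkcond !big_ord_recr big_ord0 /= add0r.
  by do 2?congr (_ + _); congr (if P _ then F _ else _);
    apply/val_inj; rewrite /= inordK.
rewrite /g !big_ord_recr big_ord0 /= !sumE !mxE !inordK //= !(addr0, add0r).
by rewrite big_ord0 add0r normr1 powR1 addrA.
Qed.

(* Main.v *)
(* On this region every base of a power is positive and, with
   S = 1 + theta1 + theta2, the four positive terms pair off as
   1 + (theta1 + theta2) = S and (1 + theta1) + theta2 = S. So g is a sum of two
   terms x `^ alpha + y `^ alpha - (x + y) `^ alpha with x, y > 0, whose sign
   expresses the strict super- or subadditivity of the power function.
   Superadditivity for p > 1 follows from x `^ p = x * x `^ (p - 1), and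
   subadditivity for p < 1 from superadditivity at the exponent p^-1. *)
Require Import Defs.
From mathcomp Require Import all_boot all_order all_algebra.
From mathcomp Require Import reals exp.
From mathcomp Require Import lra.
Set Implicit Arguments.
Unset Strict Implicit.
Unset Printing Implicit Defensive.
Import Order.TTheory GRing.Theory Num.Theory.
Local Open Scope ring_scope.

Lemma powR_superadditive (R : realType) (p x y : R) : 1 < p -> 0 < x -> 0 < y ->
  x `^ p + y `^ p < (x + y) `^ p.
Proof.
move=> p_gt1 x_gt0 y_gt0.
have p_gt0 : 0 < p by lra.
have powRE z : 0 < z -> z `^ p = z * z `^ (p - 1).
  by move=> z_gt0; rewrite mulr_powRB1 ?ltW.
rewrite (powRE x)// (powRE y)// powRE ?addr_gt0// mulrDl.
(* Since [p - 1] is positive, each cofactor is strictly below that of [x + y]. *)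
by apply: ltrD; rewrite ltr_pM2l// gt0_ltr_powR ?nnegrE//; lra.
Qed.

Lemma powR_subadditive (R : realType) (p x y : R) : 0 < p < 1 -> 0 < x -> 0 < y ->
  (x + y) `^ p < x `^ p + y `^ p.
Proof.
move=> /andP[p_gt0 p_lt1] x_gt0 y_gt0.
have powRVK z : 0 <= z -> (z `^ p) `^ p^-1 = z.
  by move=> z_ge0; rewrite -powRrM divff ?gt_eqF// powRr1.
have pV_gt1 : 1 < p^-1 by rewrite invf_gt1.
have := powR_superadditive pV_gt1 (powR_gt0 p x_gt0) (powR_gt0 p y_gt0).
rewrite !powRVK ?ltW// => lt_xy.
(* The right side becomes its [p^-1]-th power raised to [p], so [lt_xy] can be raised to the power
   [p]. *)
rewrite -[ltRHS]powRr1 ?addr_ge0 ?powR_ge0// -(mulVf (lt0r_neq0 p_gt0)) powRrM.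
by rewrite gt0_ltr_powR ?nnegrE ?powR_ge0 ?addr_ge0 ?ltW.
Qed.

Theorem theorem10 (R : realType) (theta1 theta2 : R)
    (theta2_gt0 : 0 < theta2) (theta2_lt1 : theta2 < 1)
    (sum_gt0 : theta1 + theta2 > 0) (diff_lt1 : theta1 - theta2 < 1)
    (alpha : R) (alpha_gt0 : 0 < alpha) (alpha_le2 : alpha <= 2) :
  [/\ 0 < alpha < 1 -> g alpha (ma2_coef theta1 theta2) > 0,
      alpha = 1 -> g alpha (ma2_coef theta1 theta2) = 0
    & 1 < alpha <= 2 -> g alpha (ma2_coef theta1 theta2) < 0].
Proof.
(* [sum_gt0] and [theta2_lt1] give [theta1 > - theta2 > -1]. *)
have theta1D1_gt0 : 0 < 1 + theta1 by lra.
rewrite g_ma2E !gtr0_norm//; last by lra.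
split=> [alpha01 | -> | /andP[alpha_gt1 _]].
- have := powR_subadditive alpha01 ltr01 sum_gt0.
  have := powR_subadditive alpha01 theta1D1_gt0 theta2_gt0.
  (* Reassociating makes both powers of the total the same atom for [lra]. *)
  by rewrite powR1 addrA; lra.
- by rewrite !powRr1; lra.
- have := powR_superadditive alpha_gt1 ltr01 sum_gt0.
  have := powR_superadditive alpha_gt1 theta1D1_gt0 theta2_gt0.
  by rewrite powR1 addrA; lra.
Qed.
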